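(* For every real $\alpha>\frac{1}{2}$ there exist an integer $N_0$ and a constant $C$ such that the following holds. Let $G$ be a simple edge-colored graph with $n\geq N_0$ vertices whose edge set is partitioned into $n$ color classes $\mathcal{F}=(F_1,\ldots,F_n)$, with $\mathcal{F}=\mathcal{F}_M\cup\mathcal{F}_T\cup\mathcal{F}_S$ where every $F_i\in\mathcal{F}_M$ is a matching of size $2$, every $F_i\in\mathcal{F}_T$ is a triangle, every $F_i\in\mathcal{F}_S$ is a single edge, and $|\mathcal{F}_M\cup\mathcal{F}_T|\geq\alpha n$. Then $G$ contains a rainbow cycle of length at most $C\log n$.
   Context: An edge-colored graph is a graph $G$ with a map $c:E(G)\to\mathbb{N}$; the color classes are the sets of edges of a given color. A cycle is rainbow if its distinct edges come from distinct color classes. A matching of size $2$ is a set of two vertex-disjoint edges; a triangle is the edge set of a $3$-cycle. Logarithms are to base $2$. *)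

(* Defs.v *)
From mathcomp Require Import all_boot all_order all_algebra.
From mathcomp Require Import reals exp.

Set Implicit Arguments.
Unset Strict Implicit.
Unset Printing Implicit Defensive.

Import Order.TTheory GRing.Theory Num.Theory.
Local Open Scope ring_scope.

Record sgraph (V : finType) := SGraph {
  adj :> rel V;
  adj_sym : symmetric adj;
  adj_irr : irreflexive adj
}.

Section EdgeColoredGraph.
Variables (V : finType) (G : sgraph V).

Definition edges : {set {set V}} :=
  [set [set xy.1; xy.2] | xy : V * V & G xy.1 xy.2].

(* Only the values of [c] on [edges] matter. *)
Variable c : {set V} -> nat.

Definition color_class (i : nat) : {set {set V}} :=
  [set e in edges | c e == i].

(* The nonempty color classes. *)
Definition color_classes : {set {set {set V}}} :=
  [set color_class (c e) | e in edges].

(* [p] lists the vertices of a cycle in cyclic order, so that the length of the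
   cycle is [size p]. *)
Definition is_cycle (p : seq V) : Prop :=
  [/\ (3 <= size p)%N, uniq p & cycle G p].

Definition cycle_edges (p : seq V) : {set {set V}} :=
  [set [set x; next p x] | x in p].

Definition rainbow (p : seq V) : Prop := {in cycle_edges p &, injective c}.

End EdgeColoredGraph.

Section ClassTypes.
Variable V : finType.

Definition is_matching2 (F : {set {set V}}) : Prop :=
  exists e f : {set V}, [/\ F = [set e; f], e != f & [disjoint e & f]].

Definition is_triangle (F : {set {set V}}) : Prop :=
  exists x y z : V, uniq [:: x; y; z] /\
    F = [set [set x; y]; [set y; z]; [set z; x]].

Definition is_single_edge (F : {set {set V}}) : Prop :=
  exists e : {set V}, F = [set e].

End ClassTypes.

Definition log2 (R : realType) (x : R) : R := ln x / ln 2.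

(* Main.v *)
Require Import Defs.
From mathcomp Require Import all_boot all_order all_algebra.
From mathcomp Require Import boolp reals exp zify lra.

Set Implicit Arguments.
Unset Strict Implicit.
Unset Printing Implicit Defensive.

Import Order.TTheory GRing.Theory Num.Theory.

(** Since the classes that are single edges cover at most [2(1 - alpha)n] vertices
    and the total degree is linear, linearly many vertices of bounded degree meet no
    single-edge class.  Among them a maximal set [J] of vertices, no two of which meet
    a common class, still has linear size.  Every class has an edge avoiding [J]: the
    other edge of a matching, the opposite edge of a triangle.  Selecting one such edge
    per class gives [n] edges of distinct colors on only [n - #|J|] vertices, that is,
    at least [(1 + 1/k)] edges per vertex for a constant [k].

    In a vertex-minimal subgraph of that density every vertex set [S] touches at least
    [(1 + 1/k)#|S|] edges.  As long as the ball of radius [r + 1] around a vertex spans a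
    tree, it therefore has at least [(1 + 1/k)] times as many vertices as the ball of
    radius [r], so a cycle appears at some radius [O(log n)]. *)

(** * Short cycles in dense edge sets *)

Section ShortCycle.
Variable V : finType.
Implicit Types (E T : {set {set V}}) (B S W : {set V}) (x y v a b : V).

Definition link E : rel V := fun x y => [set x; y] \in E.

Lemma link_sym E : symmetric (link E).
Proof. by move=> x y; rewrite /link setUC. Qed.

Definition reach T v r x : Prop :=
  exists p, [/\ path (link T) v p, last v p = x & size p <= r].

Definition short_cycle E m : Prop :=
  exists p, [/\ 3 <= size p, uniq p, cycle (link E) p & size p <= m].

Lemma link_sub E T : T \subset E -> subrel (link T) (link E).
Proof. by move=> /subsetP sTE x y /sTE. Qed.

Lemma reach_sub E T v r s x :
  T \subset E -> r <= s -> reach T v r x -> reach E v s x.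
Proof.
move=> sTE rs [p [pP lp sp]]; exists p; split => //; last exact: leq_trans rs.
exact: sub_path (link_sub sTE) _ _ pP.
Qed.

(** Going back from [a] to [v] and on to [b] is a walk in [T] with at most [2 * r] edges. Shortened
    to a path, it has at least two edges, since [a != b] and the edge [ab] is not in [T]; so that
    edge closes it to a cycle. *)
Lemma chord_short_cycle E T v r a b :
  T \subset E -> reach T v r a -> reach T v r b -> a != b ->
  [set a; b] \in E -> [set a; b] \notin T -> short_cycle E (2 * r).+1.
Proof.
move=> sTE [p [pP lp sp]] [q [qP lq sq]] nab abE abT.
have [w [wP lw sw]] : exists w, [/\ path (link T) a w, last a w = b & size w <= 2 * r].
  exists (rev (belast v p) ++ q); split.
  - rewrite cat_path -lp rev_path; apply/andP; split.
      by rewrite (eq_path (e' := link T)) // => x y; rewrite link_sym.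
    by case: p {pP lp sp} => //= y p; rewrite rev_cons last_rcons.
  - rewrite last_cat -lp; case: p {pP lp sp} => //= y p.
    by rewrite rev_cons last_rcons.
  - by rewrite size_cat size_rev size_belast; lia.
case/shortenP: wP lw sw => w' w'P uw' sw' lw' sw.
have szw : size w' <= size w by apply: uniq_leq_size => //; case/andP: uw'.
exists (a :: w'); split => //.
- case: w' w'P lw' {uw' sw' szw} => [_ /= /eqP|c [|//]] //=; first by rewrite (negbTE nab).
  by rewrite andbT /link => /[swap] ->; rewrite (negbTE abT).
- rewrite /= rcons_path (sub_path (link_sub sTE) w'P) lw' /=.
  by rewrite link_sym.
- by rewrite /= ltnS (leq_trans szw).
Qed.

Section Ball.
Variables (E : {set {set V}}) (W : {set V}) (k : nat).
Hypothesis cardE : forall e, e \in E -> #|e| = 2.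
Hypothesis subE : forall e, e \in E -> e \subset W.
Hypothesis expE : forall S, S \subset W ->
  k.+1 * #|S| <= k * #|[set e in E | ~~ [disjoint e & S]]|.

(** [B] plays the ball of radius [r] around [v] and [T] a breadth-first tree spanning it. Of the
    tree property only [#|T| < #|B|] is kept: edges touching [B] all lie in the next tree [T'], so
    [expE] gives [k.+1 * #|B| <= k * #|T'| <= k * #|B'|]. *)
Lemma tree_ball v r : v \in W -> ~ short_cycle E (2 * r).+1 ->
  exists B T, [/\ B \subset W, T \subset E, #|T| < #|B|,
    (forall x, x \in B -> reach T v r x) & k.+1 ^ r <= k ^ r * #|B|].
Proof.
move=> vW; elim: r => [_|r IH nc].
  exists [set v], set0; split; rewrite ?sub1set ?sub0set ?cards0 ?cards1 //.
  by move=> x /set1P->; exists [::].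
have [|B [T [sBW sTE ltTB rB growB]]] := IH.
  case=> p [p1 p2 p3 p4]; apply: nc; exists p; split => //.
  by apply: leq_trans p4 _; lia.
pose N := [set y | (y \notin B) && [exists x in B, link E x y]].
(* One chosen parent per new vertex, so at most [#|N|] edges are added; the default [y] does not
   occur on [N]. *)
pose par y := odflt y [pick x in B | link E x y].
have parP y : y \in N -> par y \in B /\ link E (par y) y.
  rewrite inE => /andP[_ /existsP[x /andP[xB xy]]]; rewrite /par.
  by case: pickP => [z /andP[]|/(_ x)] //; rewrite xB xy.
pose B' := B :|: N; pose T' := T :|: [set [set par y; y] | y in N].
have cB' : #|B'| = #|B| + #|N|.
  rewrite cardsU; have -> : B :&: N = set0 by apply/setP => x; rewrite !inE; case: (x \in B).
  by rewrite cards0 subn0.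
have sT'E : T' \subset E.
  rewrite subUset sTE; apply/subsetP => e /imsetP[y /parP[_ h] ->]; exact: h.
have ltTB' : #|T'| < #|B'|.
  rewrite cB' (leq_ltn_trans (leq_card_setU _ _)) // -addSn leq_add //.
  exact: leq_imset_card.
have rB' x : x \in B' -> reach T' v r.+1 x.
  case/setUP => [xB|xN].
    exact: reach_sub (subsetUl _ _) (leqnSn r) (rB _ xB).
  have [pB px] := parP _ xN; have [p [pP lp sp]] := rB _ pB.
  exists (rcons p x); rewrite last_rcons size_rcons rcons_path; split => //.
  rewrite (sub_path (link_sub (subsetUl _ _)) pP) lp /=.
  by rewrite /link inE; apply/orP; right; apply/imsetP; exists x.
exists B', T'; split => //.
  rewrite subUset sBW; apply/subsetP => y /parP[_ /subE/subsetP]; apply.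
  by rewrite !inE eqxx orbT.
(* An edge touching [B] has both ends in [B'], within distance [r.+1] of [v]; outside [T'] it would
   be a chord closing a short cycle. *)
have sT : [set e in E | ~~ [disjoint e & B]] \subset T'.
  apply/subsetP => e; rewrite inE => /andP[eE]; rewrite disjoint_sym.
  case/pred0Pn => x /andP[/= xB xe].
  have /eqP/cards2P[a [b [nab def_ab]]] := cardE eE.
  have [y [nxy def_e]] : exists y, x != y /\ e = [set x; y].
    move: xe; rewrite def_ab => /set2P[] ->; [by exists b|exists a].
    by rewrite eq_sym setUC.
  have yB' : y \in B'.
    rewrite !inE; case: (y \in B) => //=; apply/existsP; exists x.
    by rewrite xB /link -def_e.
  apply/negPn/negP => eT; apply: nc.
  apply: (@chord_short_cycle E T' v r.+1 x y); rewrite -?def_e //; apply: rB' => //.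
  by rewrite inE xB.
have := leq_trans (expE sBW) (leq_mul (leqnn k) (leq_trans (subset_leq_card sT) (ltnW ltTB'))).
rewrite !expnS => h.
apply: (leq_trans (leq_mul (leqnn k.+1) growB)).
by rewrite mulnCA [k * _]mulnC -mulnA leq_mul.
Qed.

End Ball.

(** In a minimal nonempty set [X] of this density, deleting [S] leaves a set that is sparser or
    empty, so the edges touching [S] must number at least [(1 + 1/k) * #|S|]. This is the expansion
    that makes balls grow. *)
Lemma dense_short_cycle E W k r :
  (forall e, e \in E -> #|e| = 2) -> W != set0 ->
  k.+1 * #|W| <= k * #|[set e in E | e \subset W]| ->
  k ^ r * #|V| < k.+1 ^ r -> short_cycle E (2 * r).+1.
Proof.
move=> cardE W0 dW hr.
pose P X := (X != set0) && (k.+1 * #|X| <= k * #|[set e in E | e \subset X]|).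
have [X /minsetP[/andP[X0 dX] minX] _] : {X | minset P X & X \subset W}.
  by apply: minset_exists; rewrite /P W0.
pose EX := [set e in E | e \subset X].
have [v vX] := set0Pn _ X0.
have expX S : S \subset X -> k.+1 * #|S| <= k * #|[set e in EX | ~~ [disjoint e & S]]|.
  move=> sSX; have [->|S0] := eqVneq S set0; first by rewrite cards0 muln0.
  pose Y := X :\: S.
  have cX : #|X| = #|Y| + #|S| by rewrite cardsD (setIidPr sSX) subnK ?subset_leq_card.
  have dY : k * #|[set e in E | e \subset Y]| <= k.+1 * #|Y|.
    have [->|Y0] := eqVneq Y set0.
      rewrite cards0 muln0 leqn0 muln_eq0 cards_eq0; apply/orP; right.
      apply/eqP/setP => e; rewrite !inE subset0; apply/negP => /andP[/cardE] /[swap] /eqP ->.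
      by rewrite cards0.
    rewrite leqNgt; apply/negP => /ltnW hY.
    have := minX Y; rewrite /P Y0 hY subsetDl => /(_ isT isT) eYX.
    by move: S0; rewrite -card_gt0 => S0; move: cX; rewrite eYX; lia.
  have cE : #|EX| = #|[set e in E | e \subset Y]| + #|[set e in EX | ~~ [disjoint e & S]]|.
    rewrite -(cardsID [set e : {set V} | [disjoint e & S]] EX); congr (_ + _); apply: eq_card => e;
      rewrite !inE ?subsetD; first by rewrite andbA.
    by rewrite andbC.
  move: dX; rewrite -/EX cX cE !mulnDr => h.
  by move: (leq_trans (leq_add dY (leqnn _)) h) => {h}; lia.
have [//|nc] := EM (short_cycle E (2 * r).+1).
have [|||B [T [_ _ _ _ hB]]] := @tree_ball EX X k _ _ expX v r vX.
- by move=> e; rewrite inE => /andP[/cardE].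
- by move=> e; rewrite inE => /andP[].
- case=> p [p1 p2 p3 p4]; apply: nc; exists p; split => //.
  by apply: sub_cycle p3; apply: link_sub; apply/subsetP => e; rewrite inE => /andP[].
(* Without a short cycle the ball of radius [r] would outgrow [V]. *)
have : k ^ r * #|B| <= k ^ r * #|V| by rewrite leq_mul ?max_card.
by lia.
Qed.

End ShortCycle.

(** * Large scattered sets of vertices of bounded degree *)

Lemma leq_card_bigcup (T I : finType) (P : pred I) (F : I -> {set T}) :
  #|\bigcup_(i | P i) F i| <= \sum_(i | P i) #|F i|.
Proof.
elim/big_rec2: _ => [|i n A _ leAn]; first by rewrite cards0.
by rewrite (leq_trans (leq_card_setU _ _)) // leq_add2l.
Qed.

Section Scattered.
Variables (V T : finType) (A : {set T}) (f : T -> {set V}) (s : nat).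
Hypothesis card_f : forall t, t \in A -> #|f t| <= s.

Definition deg x := #|[set t in A | x \in f t]|.

Lemma sum_deg : \sum_x deg x <= #|A| * s.
Proof.
have -> : \sum_x deg x = \sum_x \sum_(t in A) (x \in f t).
  apply: eq_bigr => x _; rewrite /deg -sum1_card big_mkcond [RHS]big_mkcond /=.
  by apply: eq_bigr => t _; rewrite inE; case: (t \in A); case: (x \in f t).
rewrite exchange_big /= -sum_nat_const; apply: leq_sum => t tA.
apply: leq_trans (card_f tA); rewrite -sum1_card [X in _ <= X]big_mkcond.
by apply: leq_sum => x _; case: (x \in f t).
Qed.

Lemma few_large_deg d : #|[set x | d < deg x]| * d.+1 <= #|A| * s.
Proof.
apply: leq_trans sum_deg; rewrite -sum_nat_const big_mkcond.
by apply: leq_sum => x _; rewrite inE; case: ifP.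
Qed.

(** Take [J] maximal in [L] with at most one point in each [f t]. A point of [L] sharing no [f t]
    with [J] could be added, so the sets [N x] for [x] in [J] cover [L], and each has at most
    [d * s + 1] points. *)
Lemma scattered_set (L : {set V}) d : (forall x, x \in L -> deg x <= d) ->
  exists J : {set V}, [/\ J \subset L, #|L| <= (d * s).+1 * #|J| &
    forall t x y, t \in A -> x \in J -> y \in J -> x \in f t -> y \in f t -> x = y].
Proof.
move=> degL.
pose P (J : {set V}) := (J \subset L) && [forall t in A, #|J :&: f t| <= 1].
have [J /maxsetP[/andP[sJL /forallP sparse] maxJ] _] : {J | maxset P J & set0 \subset J}.
  apply: maxset_exists; rewrite /P sub0set; apply/forallP => t; apply/implyP => _.
  by rewrite set0I cards0.
have sparseJ t x y : t \in A -> x \in J -> y \in J -> x \in f t -> y \in f t -> x = y.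
  move=> tA xJ yJ xt yt; have := sparse t; rewrite tA => /card_le1_eqP; apply.
    by rewrite inE yJ.
  by rewrite inE xJ.
exists J; split => //.
pose N x := x |: \bigcup_(t in A | x \in f t) f t.
have cardN x : x \in L -> #|N x| <= (d * s).+1.
  move=> xL; rewrite (leq_trans (leq_card_setU _ _)) // cards1 add1n ltnS.
  apply: leq_trans (leq_card_bigcup _ _) _ => /=.
  apply: leq_trans (_ : \sum_(t in A | x \in f t) s <= _).
    by apply: leq_sum => t /andP[tA _]; exact: card_f.
  rewrite sum_nat_const leq_mul // (leq_trans _ (degL x xL)) // /deg.
  by apply: subset_leq_card; apply/subsetP => t; rewrite inE.
have sLN : L \subset \bigcup_(x in J) N x.
  apply/subsetP => y yL; apply/negPn/negP => yN.
  have yNx x : x \in J -> y \notin N x.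
    by move=> xJ; apply: contra yN => yx; apply/bigcupP; exists x.
  have yJ : y \notin J by apply/negP => yJ; move: (yNx y yJ); rewrite !inE eqxx.
  have := maxJ (y |: J); rewrite subsetUr => h.
  move: yJ; rewrite -h ?setU11 // /P subUset sub1set yL sJL /=.
  apply/forallP => t; apply/implyP => tA.
  have hJ : #|J :&: f t| <= 1 by move: (sparse t); rewrite tA.
  have [yt|yt] := boolP (y \in f t); last first.
    apply: leq_trans hJ; apply: subset_leq_card; apply/subsetP => z.
    by rewrite !inE => /andP[/orP[/eqP->|->//]]; rewrite (negbTE yt).
  rewrite -(cards1 y); apply: subset_leq_card; apply/subsetP => z.
  rewrite !inE => /andP[/orP[//|zJ] zt]; case/negP: (yNx z zJ).
  by rewrite !inE; apply/orP; right; apply/bigcupP; exists t => //; rewrite tA.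
apply: leq_trans (subset_leq_card sLN) _.
apply: leq_trans (leq_card_bigcup _ _) _.
rewrite mulnC -sum_nat_const; apply: leq_sum => x xJ.
by apply: cardN; apply: (subsetP sJL).
Qed.

End Scattered.

(** * Exponential growth against the logarithm *)

Lemma bernoulli_expn k r : k ^ r * (k + r) <= k.+1 ^ r * k.
Proof.
elim: r => [|r IH]; first by rewrite !expn0 addn0.
rewrite !expnS; set a := k ^ r in IH *; set b := k.+1 ^ r in IH *.
have : k.+1 * (a * (k + r)) <= k.+1 * (b * k) by rewrite leq_mul.
nia.
Qed.

(** By Bernoulli's inequality every [k] steps of growth by [1 + 1/k] at least double, and
    [trunc_log 2 n + 1] doublings exceed [n]. *)
Lemma expn_trunc_log_gt k n : 0 < k ->
  k ^ (k * (trunc_log 2 n).+1) * n < k.+1 ^ (k * (trunc_log 2 n).+1).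
Proof.
move=> k_gt0; set t := (trunc_log 2 n).+1.
have double : 2 * k ^ k <= k.+1 ^ k.
  have := bernoulli_expn k k; rewrite addnn -mul2n mulnA leq_pmul2r //.
  by rewrite mulnC.
have n_lt : n < 2 ^ t by apply: trunc_log_ltn.
rewrite !expnM; apply: leq_trans (_ : (2 * k ^ k) ^ t <= _); last first.
  by rewrite leq_exp2r.
by rewrite expnMn mulnC ltn_pmul2r // !expn_gt0 k_gt0.
Qed.

(** * Color classes, their representatives and the rainbow cycle *)

Section RainbowCycle.
Variables (V : finType) (G : sgraph V) (c : {set V} -> nat).
Variables (FM FT FS : {set {set {set V}}}).
Hypothesis nclasses : #|color_classes G c| = #|V|.
Hypothesis def_classes : color_classes G c = FM :|: FT :|: FS.
Hypothesis FM_matching : forall F, F \in FM -> is_matching2 F.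
Hypothesis FT_triangle : forall F, F \in FT -> is_triangle F.
Hypothesis FS_single : forall F, F \in FS -> is_single_edge F.

Let CC := color_classes G c.

Lemma edges_set2 x y : ([set x; y] \in edges G) = G x y.
Proof.
apply/imsetP/idP => [[[u v]] /=|Gxy]; last by exists (x, y); rewrite ?inE.
rewrite inE /= => Guv exy.
have : x \in [set u; v] by rewrite -exy set21.
have : y \in [set u; v] by rewrite -exy set22.
have : u \in [set x; y] by rewrite exy set21.
have : v \in [set x; y] by rewrite exy set22.
have Gvu : G v u by rewrite adj_sym.
by do 4![case/set2P => ?; subst].
Qed.

Lemma card_edge e : e \in edges G -> #|e| = 2.
Proof.
case/imsetP => -[x y]; rewrite inE /= => Gxy ->; rewrite cards2.
by case: eqVneq Gxy => // ->; rewrite adj_irr.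
Qed.

Lemma class_edge F e : F \in CC -> e \in F -> e \in edges G /\ F = color_class G c (c e).
Proof.
case/imsetP => e' _ -> /[dup] eF; rewrite inE => /andP[eE /eqP ce]; split => //.
by rewrite ce.
Qed.

Lemma double_sub : FM :|: FT \subset CC.
Proof. by rewrite /CC def_classes subsetUl. Qed.

Lemma single_class F : F \in CC :\: (FM :|: FT) -> exists e, F = [set e].
Proof.
by rewrite inE /CC def_classes [_ \in _ :|: FS]inE => /andP[/negbTE-> /= /FS_single].
Qed.

Lemma double_avoid F x : F \in FM :|: FT -> exists2 e, e \in F & x \notin e.
Proof.
case/setUP => [/FM_matching[e [f [-> _ dis]]]|/FT_triangle[u [v [w [uq ->]]]]].
  have [xe|] := boolP (x \in e); last by exists e; rewrite ?set21.
  by exists f; rewrite ?set22 // (disjointFr dis xe).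
move: uq; rewrite /= !inE negb_or andbT => /andP[/andP[uv uw] vw].
have [xu|xu] := eqVneq x u.
  by exists [set v; w]; rewrite ?inE ?eqxx ?orbT // xu negb_or uv uw.
have [xv|xv] := eqVneq x v; last by exists [set u; v]; rewrite !inE ?eqxx // negb_or xu.
by exists [set w; u]; rewrite !inE ?eqxx ?orbT // negb_or xu xv vw.
Qed.

Lemma card_cover_single F : F \in CC :\: (FM :|: FT) -> #|cover F| <= 2.
Proof.
move=> FC; have [e eF] := single_class FC.
move: FC => /setDP[FC _]; rewrite eF cover1.
by rewrite card_edge //; apply: (class_edge FC _).1; rewrite eF set11.
Qed.

Lemma card_cover_class F : F \in CC -> #|cover F| <= 4.
Proof.
move=> FC; have edgeF e : e \in F -> #|e| = 2 by case/(class_edge FC) => /card_edge.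
have [|] := boolP (F \in FM :|: FT); last first.
  by move=> h; apply: leq_trans (_ : 2 <= 4); rewrite // card_cover_single // inE h.
case/setUP => [/FM_matching[e [f [eF _ _]]]|/FT_triangle[u [v [w [_ eF]]]]].
  have ce : #|e| = 2 by apply: edgeF; rewrite eF set21.
  have cf : #|f| = 2 by apply: edgeF; rewrite eF set22.
  rewrite eF /cover bigcup_setU !big_set1.
  by rewrite (leq_trans (leq_card_setU _ _)) // ce cf.
apply: leq_trans (_ : #|[set u; v; w]| <= _); last first.
  rewrite (leq_trans (leq_card_setU _ _)) // cards1 (leq_trans (n := 2 + 1)) // leq_add2r.
  by rewrite cards2; case: eqVneq.
apply: subset_leq_card; apply/bigcupsP => e; rewrite eF !inE => /orP[/orP[]|] /eqP ->;
by apply/subsetP => z; rewrite !inE => /orP[] /eqP ->; rewrite eqxx ?orbT.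
Qed.

(** With [n = #|V|], the hypothesis says that at least [(1/2 + 1/(2m)) n] classes are matchings or
    triangles. The others cover at most [(1 - 1/m) n] vertices, and discarding at most [n/(2m)]
    vertices of large degree leaves [n/(2m)] candidates for [J]. *)
Lemma free_scattered_set m : #|V| + m * #|V| <= 2 * m * #|FM :|: FT| ->
  exists J : {set V}, [/\ #|V| <= 2 * m * (32 * m).+1 * #|J|,
    (forall F x, F \in CC :\: (FM :|: FT) -> x \in J -> x \notin cover F) &
    forall F x y, F \in CC -> x \in J -> y \in J -> x \in cover F -> y \in cover F -> x = y].
Proof.
move=> hm.
pose S := CC :\: (FM :|: FT).
pose X := \bigcup_(F in S) cover F.
(* Classes cover at most 4 vertices each, so the threshold [8 * m] keeps [#|H|] below [n/(2m)]. *)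
pose H := [set x | 8 * m < deg CC cover x].
have cS : #|S| + #|FM :|: FT| = #|V|.
  by rewrite cardsD (setIidPr double_sub) nclasses subnK // -nclasses subset_leq_card ?double_sub.
have cX : #|X| <= 2 * #|S|.
  apply: leq_trans (leq_card_bigcup _ _) _; rewrite mulnC -sum_nat_const.
  by apply: leq_sum => F; apply: card_cover_single.
have cH : #|H| * (8 * m).+1 <= #|V| * 4.
  by rewrite -nclasses; apply: few_large_deg => F; apply: card_cover_class.
pose L := ~: (X :|: H).
have cL : #|V| <= #|L| + (#|X| + #|H|).
  by rewrite -(cardsC (X :|: H)) addnC leq_add2l leq_card_setU.
have [|J [sJL cJ sparse]] := @scattered_set _ _ CC cover 4 card_cover_class L (8 * m).
  by move=> x; rewrite !inE negb_or -leqNgt => /andP[].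
exists J; split => //.
  have {cJ} cJ : #|L| <= (32 * m).+1 * #|J| by apply: leq_trans cJ _; rewrite leq_mul //; lia.
  rewrite -mulnA; apply: leq_trans (leq_mul (leqnn (2 * m)) cJ).
  move: hm cS cX cH cL; clear; set v := #|V|; set l := #|L|; set h := #|H|; set x := #|X|.
  set s := #|S|; set d := #|FM :|: FT|.
  move=> hm cS cX cH cL.
  have : m * v <= m * (l + (2 * s + h)) by rewrite leq_mul //; lia.
  have : m * (s + d) = m * v by rewrite cS.
  nia.
move=> F x FS' xJ; have := subsetP sJL _ xJ; rewrite !inE negb_or => /andP[+ _].
by apply: contra => xF; apply/bigcupP; exists F.
Qed.

(** A single-edge class misses [J] altogether; any other class meets [J] in at most one vertex,
    which one of its edges avoids. *)
Lemma avoiding_representative (J : {set V}) :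
  (forall F x, F \in CC :\: (FM :|: FT) -> x \in J -> x \notin cover F) ->
  (forall F x y, F \in CC -> x \in J -> y \in J -> x \in cover F -> y \in cover F -> x = y) ->
  forall F, F \in CC -> exists2 e, e \in F & e \subset ~: J.
Proof.
move=> freeJ sparseJ F FC.
have coverP e x : e \in F -> x \in e -> x \in cover F.
  by move=> eF xe; apply/bigcupP; exists e.
have [Fd|Fd] := boolP (F \in FM :|: FT); last first.
  have FS' : F \in CC :\: (FM :|: FT) by rewrite inE Fd.
  have [e eF] := single_class FS'; exists e; first by rewrite eF set11.
  apply/subsetP => x xe; rewrite inE; apply/negP => /(freeJ _ _ FS')/negP; apply.
  by apply: coverP xe; rewrite eF set11.
have [Z|[x]] := set_0Vmem (J :&: cover F).
  have [e eF] : exists e, e \in F.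
    by move: FC => /imsetP[e eE ->]; exists e; rewrite inE eE /=.
  exists e => //; apply/subsetP => x xe; rewrite inE; apply/negP => xJ.
  by have := in_set0 x; rewrite -Z inE xJ (coverP e).
case/setIP => xJ xF; have [e eF xe] := double_avoid x Fd.
exists e => //; apply/subsetP => y ye; rewrite inE; apply/negP => yJ.
by case/negP: xe; rewrite (sparseJ F x y) // (coverP e).
Qed.

Lemma short_rainbow_cycle m : 0 < #|V| -> 0 < m ->
  #|V| + m * #|V| <= 2 * m * #|FM :|: FT| ->
  exists p, [/\ is_cycle G p, rainbow c p &
    size p <= (2 * ((2 * m * (32 * m).+1) * (trunc_log 2 #|V|).+1)).+1].
Proof.
move=> V_gt0 m_gt0 /free_scattered_set[J [cJ freeJ sparseJ]].
set k := 2 * m * _ in cJ *.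
pose rep (F : {set {set V}}) := odflt set0 [pick e in F | e \subset ~: J].
have repP F : F \in CC -> rep F \in F /\ rep F \subset ~: J.
  move=> FC; have [e eF eJ] := avoiding_representative freeJ sparseJ FC.
  by rewrite /rep; case: pickP => [e' /andP[]|/(_ e)] //; rewrite eF eJ.
(* A class is recovered from the color of its representative: hence [rep] is injective on [CC], and
   the edges of [E] have distinct colors. *)
have repK F : F \in CC -> F = color_class G c (c (rep F)).
  by move=> FC; have [_] := class_edge FC (repP _ FC).1.
pose E := rep @: CC.
have edgeE e : e \in E -> e \in edges G.
  by case/imsetP => F FC ->; have [] := class_edge FC (repP _ FC).1.
have cE : #|E| = #|V|.
  by rewrite card_in_imset // => F F' /repK {2}-> /repK {2}-> ->.
have sEJ : [set e in E | e \subset ~: J] = E.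
  apply/setP => e; rewrite inE andb_idr // => /imsetP[F FC ->].
  exact: (repP _ FC).2.
have k_gt0 : 0 < k by rewrite /k !muln_gt0 m_gt0.
have cVJ : #|V| = #|J| + #|~: J| by rewrite cardsC.
have [||||p [p3 up cp sp]] := @dense_short_cycle V E (~: J) k (k * (trunc_log 2 #|V|).+1).
- by move=> e /edgeE /card_edge.
- apply/eqP => J0; have [e eE] : exists e, e \in E.
    by apply/set0Pn; rewrite -card_gt0 cE.
  have: e \in [set e in E | e \subset ~: J] by rewrite sEJ.
  rewrite inE eE J0 subset0 => /eqP e0.
  by have := card_edge (edgeE _ eE); rewrite e0 cards0.
(* From [#|V| <= k * #|J|], the [#|V|] edges on [#|V| - #|J|] vertices have density at least
   [1 + 1/k]. *)
- by rewrite sEJ cE; move: cJ; rewrite cVJ; nia.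
- exact: expn_trunc_log_gt.
exists p; split => //.
  split => //; apply: sub_cycle cp => x y /edgeE; by rewrite edges_set2.
have sub_cyc : cycle_edges p \subset E.
  by apply/subsetP => e /imsetP[x xp ->]; exact: next_cycle cp xp.
move=> e f /(subsetP sub_cyc)/imsetP[F FC ->] /(subsetP sub_cyc)/imsetP[F' FC' ->] cc.
by rewrite (repK _ FC) cc -repK.
Qed.

End RainbowCycle.

(** * From natural-number bounds to the real constants *)

Local Open Scope ring_scope.

Lemma trunc_log_le_log2 (R : realType) (n : nat) : (0 < n)%N ->
  (trunc_log 2 n)%:R <= log2 n%:R :> R.
Proof.
move=> n_gt0; have ln2 : 0 < ln 2 :> R by rewrite ln_gt0 // ltr1n.
rewrite /log2 ler_pdivlMr // mulr_natl -lnXn ?ltr0n // ler_ln ?posrE ?exprn_gt0 ?ltr0n //.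
by rewrite -natrX ler_nat trunc_logP.
Qed.

Theorem theorem3p1 (R : realType) (alpha : R) (halpha : 1 / 2 < alpha) :
  exists (N0 : nat) (C : R),
  forall (V : finType) (G : sgraph V) (c : {set V} -> nat)
         (FM FT FS : {set {set {set V}}}),
    (N0 <= #|V|)%N ->
    #|color_classes G c| = #|V| ->
    color_classes G c = FM :|: FT :|: FS ->
    (forall F, F \in FM -> is_matching2 F) ->
    (forall F, F \in FT -> is_triangle F) ->
    (forall F, F \in FS -> is_single_edge F) ->
    alpha * #|V|%:R <= #|FM :|: FT|%:R ->
    exists p : seq V,
      [/\ is_cycle G p, rainbow c p & (size p)%:R <= C * log2 #|V|%:R].
Proof.
pose a := 2 * alpha - 1.
have a_gt0 : 0 < a by rewrite /a; lra.
(* Chosen so that [1/m <= 2 * alpha - 1], that is, [alpha >= 1/2 + 1/(2m)]. *)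
pose m := (Num.bound a^-1).+1.
have m_a : 1 <= m%:R * a.
  rewrite -ler_pdivrMr // mul1r /m -natr1.
  have := archi_boundP (ltW (_ : 0 < a^-1)); rewrite invr_gt0 => /(_ a_gt0); lra.
pose k := (2 * m * (32 * m).+1)%N.
exists 2%N, (4 * k + 1)%:R => V G c FM FT FS n_ge2 nC defC hM hT hS hal.
have hm : (#|V| + m * #|V| <= 2 * m * #|FM :|: FT|)%N.
  rewrite -(ler_nat R) natrD !natrM.
  set n : R := #|V|%:R in hal *; set d : R := #|FM :|: FT|%:R in hal *.
  have n_ge0 : 0 <= n by rewrite ler0n.
  have h1 : 2 * m%:R * (alpha * n) <= 2 * m%:R * d by rewrite ler_wpM2l // mulr_ge0 ?ler0n.
  have h2 : 1 * n <= m%:R * a * n by rewrite ler_wpM2r.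
  by move: h1 h2; rewrite /a; lra.
have [|//|p [cp rp sp]] := short_rainbow_cycle nC defC hM hT hS _ _ hm.
  exact: ltnW.
exists p; split => //.
have V_gt0 : (0 < #|V|)%N by exact: ltnW.
apply: le_trans (ler_wpM2l (ler0n _ _) (trunc_log_le_log2 R V_gt0)).
(* With [t = trunc_log 2 #|V|], the bound [2k(t + 1) + 1] is at most [(4k + 1)t] because [t >= 1],
   which is what [N0 = 2] provides. *)
rewrite -natrM ler_nat (leq_trans sp) // -/k.
have : (0 < trunc_log 2 #|V|)%N by rewrite trunc_log_gt0.
nia.
Qed.
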